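(* Suppose that for each task $q\in\mathcal Q$ not all agents are dominating for $q$, and suppose that for each $q\in\mathcal Q$ there exists a unique dominating agent $i_q^*\in\mathcal A$. Let $\gamma_i^q>0$ for all $i\in\mathcal A$, $q\in\mathcal Q$, and define $\gamma=\min_{i\in\mathcal A,\,q\in\mathcal Q}\gamma_i^q>0$ and $\delta=\min_{q\in\mathcal Q}\big[f_{i_q^*}(q)-\max_{j\ne i_q^*}f_j(q)\big]>0$. Consider the dynamics $$w_i^q(t+1)=\big[w_i^q(t)+\gamma_i^q\,u_i^q(\mathbf w^q(t))\big]_0^1,\qquad i\in\mathcal A,\ q\in\mathcal Q,\ t\in\mathbb Z_{\ge0},$$ starting from $\mathbf W(0)\in[0,1]^{n\times m}$, with the solution trajectory $\mathbf W(t)=(w_i^q(t))\to\bar{\mathbf W}=(\bar w_i^q)\in\mathcal W$ as $t\to\infty$, where $\mathcal W$ is the set of equilibrium points of the dynamics. Then $$w_i^q(t)=\bar w_i^q\qquad\forall i\in\mathcal A,\ \forall q\in\mathcal Q,\ \forall t\ge 2\big\lceil(\gamma\delta)^{-1}\big\rceil .$$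
   Context: $\mathcal A=\{1,\dots,n\}$ is a finite set of agents and $\mathcal Q=\{1,\dots,m\}$ a finite set of tasks. For each $i\in\mathcal A$, $f_i:\mathcal Q\to\mathbb R_{\ge 0}$ is a given function. Agent $i$ is dominating for task $q$ if $f_i(q)\ge f_j(q)$ for all $j\in\mathcal A$. It is the unique dominating agent for $q$ if it is the only agent with this property. For $x\in\mathbb R$, $[x]_0^1=\max\{0,\min\{x,1\}\}$. For $\mathbf W=(w_i^q)\in[0,1]^{n\times m}$, $\mathbf w^q=(w_i^q)_{i\in\mathcal A}\in[0,1]^n$, and $$u_i^q(\mathbf w^q)=f_i(q)-\max_{j\in\mathcal A\setminus\{i\}}f_j(q)w_j^q .$$ The set of equilibrium points is $$\mathcal W=\big\{\mathbf W\in[0,1]^{n\times m}:\ [w_i^q+\gamma_i^q u_i^q(\mathbf w^q)]_0^1=w_i^q\ \ \forall i\in\mathcal A,\ \forall q\in\mathcal Q\big\}.$$ *)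

(* Defs.v *)
From HB Require Import structures.
From mathcomp Require Import all_boot all_order all_algebra.
From mathcomp Require Import all_classical all_reals all_analysis.
Import Order.TTheory GRing.Theory Num.Theory.
Import numFieldNormedType.Exports.

Set Implicit Arguments.
Unset Strict Implicit.
Unset Printing Implicit Defensive.

Local Open Scope classical_set_scope.
Local Open Scope ring_scope.

Definition is_min (R : realType) (A : set R) (x : R) : Prop := A x /\ lbound A x.

Definition clip01 (R : realType) (x : R) : R := Num.max 0 (Num.min x 1).

Definition dominating (R : realType) (n m : nat) (f : 'I_n -> 'I_m -> R)
    (i : 'I_n) (q : 'I_m) : Prop :=
  forall j : 'I_n, f j q <= f i q.

Definition unique_dominating (R : realType) (n m : nat)
    (f : 'I_n -> 'I_m -> R) (i : 'I_n) (q : 'I_m) : Prop :=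
  dominating f i q /\ (forall j : 'I_n, dominating f j q -> j = i).

(* Maximum of [g] over the agents other than [i]. The base value 0 does not
   affect the result when [g] is nonnegative and there are at least two
   agents. *)
Definition max_others (R : realType) (n : nat) (g : 'I_n -> R) (i : 'I_n) : R :=
  \big[Num.max/0]_(j < n | j != i) g j.

(* [w] is the column w^q of the matrix of weights W, whose entry W i q is
   w_i^q. *)
Definition utility (R : realType) (n m : nat) (f : 'I_n -> 'I_m -> R)
    (i : 'I_n) (q : 'I_m) (w : 'cV[R]_n) : R :=
  f i q - max_others (fun j => f j q * w j ord0) i.

Definition unit_cube (R : realType) (n m : nat) : set 'M[R]_(n, m) :=
  [set W | forall i q, 0 <= W i q <= 1].
Arguments unit_cube : clear implicits.

Definition equilibria (R : realType) (n m : nat)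
    (f gamma_ : 'I_n -> 'I_m -> R) : set 'M[R]_(n, m) :=
  [set W | unit_cube R n m W /\
    forall i q, clip01 (W i q + gamma_ i q * utility f i q (col q W)) = W i q].

(* Main.v *)
Require Import Defs.
From mathcomp Require Import all_boot all_order all_algebra.
From mathcomp Require Import zify ring lra.
From mathcomp Require Import all_classical all_reals all_analysis.

Set Implicit Arguments.
Unset Strict Implicit.
Unset Printing Implicit Defensive.

Import Order.TTheory GRing.Theory Num.Theory.
Import numFieldNormedType.Exports.
Local Open Scope classical_set_scope.
Local Open Scope ring_scope.

(** For a fixed task, the dominating agent gains at every step, whatever the
    weights are, because its utility is smallest when all the other weights
    equal 1, and then it is still at least delta.  So its weight grows by at
    least gamma * delta per step until it is 1, which happens after
    T = ceil ((gamma * delta)^-1) steps at the latest, and then stays there.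
    From that moment every other agent competes against the full value of the
    dominating one, has utility at most - delta, and loses at least
    gamma * delta per step, so its weight is 0 after T further steps.  This is
    [weight_after_2T]: from time 2 T on, the weights of the task are the
    indicator of the dominating agent, for every trajectory in the unit cube.

    An equilibrium is a constant trajectory, so it is that indicator too; hence
    the trajectory and its limit agree from time 2 T on. *)

Lemma clip01_bounds (R : realType) (x : R) : 0 <= clip01 x <= 1.
Proof. by rewrite /clip01 le_max lexx /= ge_max ler01 ge_min lexx orbT. Qed.

Lemma clip01_opp (R : realType) (x : R) : clip01 (1 - x) = 1 - clip01 x.
Proof.
rewrite /clip01 !maxEle !minEle.
by do ?case: ifP => //; lra.
Qed.

(** Clipping at 1 is the only thing that can stop an upward drift, so x s stays
    above min 1 (s * c).  The induction absorbs both cases of the minimum, hence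
    the value 1 is kept once it is reached. *)
Lemma clip01_drift_up (R : realType) (x d : nat -> R) (c : R) (k t : nat) :
  0 <= x 0%N -> (forall s, x s.+1 = clip01 (x s + d s)) ->
  (forall s, c <= d s) -> 1 <= k%:R * c -> (k <= t)%N ->
  x t = 1.
Proof.
move=> x0 xS cd kc kt.
have k0 : (0 < k)%N by case: (k) kc => //; rewrite mul0r ler10.
have c0 : 0 <= c.
  rewrite leNgt; apply/negP => /ltW c_le0.
  by have := mulr_ge0_le0 (ler0n R k) c_le0; lra.
have lower s : Num.min 1 (s%:R * c) <= x s.
  elim: s => [|s IH]; first by rewrite mul0r ge_min x0 orbT.
  rewrite xS /clip01 le_max; apply/orP; right.
  rewrite le_min ge_min [X in _ && X]ge_min lexx /= andbT.
  move: (cd s) IH; rewrite ge_min -natr1 mulrDl mul1r.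
  by move=> ? /orP[?|?]; apply/orP; [left|right]; lra.
have tc : 1 <= t%:R * c.
  by apply: le_trans kc _; apply: ler_wpM2r => //; rewrite ler_nat.
apply/le_anti/andP; split; last by have := lower t; rewrite min_l.
case: t kt {tc} => [|t _]; first by rewrite leqn0 => /eqP k_0; rewrite k_0 in k0.
by rewrite xS; case/andP: (clip01_bounds (x t + d t)).
Qed.

(** The reflection x |-> 1 - x exchanges upward and downward drift. *)
Lemma clip01_drift_down (R : realType) (x d : nat -> R) (c : R) (k t : nat) :
  x 0%N <= 1 -> (forall s, x s.+1 = clip01 (x s + d s)) ->
  (forall s, d s <= - c) -> 1 <= k%:R * c -> (k <= t)%N ->
  x t = 0.
Proof.
move=> x1 xS dc kc kt.
suff : 1 - x t = 1 by lra.
apply: (@clip01_drift_up _ (fun s => 1 - x s) (fun s => - d s) c k) => //.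
- by rewrite subr_ge0.
- by move=> s; rewrite xS -clip01_opp; congr clip01; ring.
- by move=> s; rewrite lerNr.
Qed.

(** The base value 0 of [max_others] needs the dominating value to be
    positive, which holds because some agent lies strictly below it. *)
Lemma unique_dominating_gap_gt0 (R : realType) (n m : nat)
    (f : 'I_n -> 'I_m -> R) (i : 'I_n) (q : 'I_m) :
  (forall j, 0 <= f j q) -> ~ (forall j, dominating f j q) ->
  unique_dominating f i q -> 0 < f i q - max_others (fun j => f j q) i.
Proof.
move=> f0 nall [idom iuniq]; rewrite subr_gt0.
have below j : ~ dominating f j q -> f j q < f i q.
  move=> njdom; rewrite lt_neqAle idom andbT; apply/eqP => fE.
  by apply: njdom => l; rewrite fE.
apply: bigmax_lt => [|j /eqP ji].
  by move/existsNP: nall => [j /below]; apply: le_lt_trans.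
by apply: below => /iuniq.
Qed.

(** Weights at most 1 can only shrink the nonnegative values that agent i
    competes against. *)
Lemma utility_ge_gap (R : realType) (n m : nat) (f : 'I_n -> 'I_m -> R)
    (i : 'I_n) (q : 'I_m) (W : 'M[R]_(n, m)) :
  (forall j, 0 <= f j q) -> unit_cube R n m W ->
  f i q - max_others (fun j => f j q) i <= utility f i q (col q W).
Proof.
move=> f0 W01; rewrite /utility lerB //.
apply: le_bigmax2 => j _; rewrite mxE.
by case/andP: (W01 j q) => _ Wle1; rewrite ler_piMr.
Qed.

(** Agent i competes against f k q at least, and f i q is itself one of the
    values in the maximum over the agents other than k. *)
Lemma utility_le_neg_gap (R : realType) (n m : nat) (f : 'I_n -> 'I_m -> R)
    (i k : 'I_n) (q : 'I_m) (W : 'M[R]_(n, m)) :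
  i != k -> W k q = 1 ->
  utility f i q (col q W) <= - (f k q - max_others (fun j => f j q) k).
Proof.
move=> ik Wk; rewrite /utility opprB lerB //.
  exact: (le_bigmax_cond _ (fun j => f j q)).
have -> : f k q = f k q * col q W k ord0 by rewrite mxE Wk mulr1.
by apply: (le_bigmax_cond _ (fun j => f j q * col q W j ord0)); rewrite eq_sym.
Qed.

(** The first T steps bring agent k to 1, the next T bring the others to 0.
    The limit value is named explicitly, so that two trajectories of the same
    dynamics can be compared without relating them step by step. *)
Lemma weight_after_2T (R : realType) (n m : nat) (f gamma_ : 'I_n -> 'I_m -> R)
    (k : 'I_n) (q : 'I_m) (gamma delta : R) (W : nat -> 'M[R]_(n, m))
    (T t : nat) (i : 'I_n) :
  (forall j, 0 <= f j q) -> (forall j, gamma <= gamma_ j q) ->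
  delta <= f k q - max_others (fun j => f j q) k ->
  0 < gamma -> 0 < delta -> 1 <= T%:R * (gamma * delta) ->
  (forall s, unit_cube R n m (W s)) ->
  (forall s j, W s.+1 j q =
     clip01 (W s j q + gamma_ j q * utility f j q (col q (W s)))) ->
  (2 * T <= t)%N -> W t i q = (i == k)%:R.
Proof.
move=> f0 gle dle g0 d0 Tgd W01 WS tT.
have Wk s : (T <= s)%N -> W s k q = 1.
  apply: (@clip01_drift_up _ (fun s => W s k q)
    (fun s => gamma_ k q * utility f k q (col q (W s))) (gamma * delta)) => //.
    by case/andP: (W01 0%N k q).
  move=> r; apply: ler_pM => //; [exact: ltW|exact: ltW|].
  exact: le_trans dle (utility_ge_gap _ f0 (W01 r)).
have [->|ik] := eqVneq i k; first by apply: Wk; lia.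
(* Restart the clock at time T, when the dominating agent has weight 1. *)
have -> : t = (T + (t - T))%N by lia.
apply: (@clip01_drift_down _ (fun s => W (T + s)%N i q)
  (fun s => gamma_ i q * utility f i q (col q (W (T + s)%N)))
  (gamma * delta) T) => //; last by lia.
- by case/andP: (W01 (T + 0)%N i q).
- by move=> s; rewrite addnS.
- move=> s; rewrite lerNr -mulrN; apply: ler_pM => //; [exact: ltW|exact: ltW|].
  rewrite lerNr; apply: le_trans (utility_le_neg_gap f ik (Wk _ (leq_addr _ _))) _.
  by rewrite lerN2.
Qed.

Theorem theoremV3 (R : realType) (n m : nat)
    (f : 'I_n -> 'I_m -> R)
    (f_ge0 : forall i q, 0 <= f i q)
    (not_all_dominating : forall q, ~ (forall i, dominating f i q))
    (istar : 'I_m -> 'I_n)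
    (istar_dominating : forall q, unique_dominating f (istar q) q)
    (gamma_ : 'I_n -> 'I_m -> R)
    (gamma_gt0 : forall i q, 0 < gamma_ i q)
    (gamma delta : R)
    (gammaE : is_min [set gamma_ p.1 p.2 | p in [set: 'I_n * 'I_m]] gamma)
    (deltaE : is_min
       [set f (istar q) q - max_others (fun j => f j q) (istar q)
         | q in [set: 'I_m]] delta)
    (W : nat -> 'M[R]_(n, m))
    (W_init : unit_cube R n m (W 0%N))
    (W_step : forall t i q,
       W t.+1 i q =
       clip01 (W t i q + gamma_ i q * utility f i q (col q (W t))))
    (Wbar : 'M[R]_(n, m))
    (W_cvg : W t @[t --> \oo] --> Wbar)
    (Wbar_equilibrium : equilibria f gamma_ Wbar) :
  forall (i : 'I_n) (q : 'I_m) (t : nat),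
    (2 * Num.ceil ((gamma * delta)^-1) <= t%:Z)%R ->
    W t i q = Wbar i q.
Proof.
move=> i q t tT.
have [[[i0 q0] _ gE] gle] := gammaE.
have [[q1 _ dE] dle] := deltaE.
have g0 : 0 < gamma by rewrite -gE.
have d0 : 0 < delta by rewrite -dE; exact: unique_dominating_gap_gt0.
have ceil0 : 0 <= Num.ceil ((gamma * delta)^-1).
  by rewrite -(ler_int R) (le_trans _ (ceil_ge _)) // invr_ge0 mulr_ge0 ?ltW.
have [T TE] : exists T : nat, Num.ceil ((gamma * delta)^-1) = T%:Z.
  by exists `|Num.ceil ((gamma * delta)^-1)|%N; rewrite gez0_abs.
have Tgd : 1 <= T%:R * (gamma * delta).
  by rewrite -ler_pdivrMr ?mulr_gt0 // div1r -[T%:R]/(T%:Z%:~R) -TE ceil_ge.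
have gleq j : gamma <= gamma_ j q by apply: gle; exists (j, q).
have dleq : delta <= f (istar q) q - max_others (fun j => f j q) (istar q).
  by apply: dle; exists q.
have W01 s : unit_cube R n m (W s).
  by case: s => // s j r; rewrite W_step; exact: clip01_bounds.
have tT2 : (2 * T <= t)%N by move: tT; rewrite TE; lia.
have [Wbar01 WbarE] := Wbar_equilibrium.
rewrite (weight_after_2T i (f_ge0^~ q) gleq dleq g0 d0 Tgd W01 (fun s j => W_step s j q) tT2).
(* A fixed point of the update is a trajectory that is constant in time. *)
by rewrite (weight_after_2T (W := fun=> Wbar) i (f_ge0^~ q) gleq dleq g0 d0 Tgd
  (fun=> Wbar01) (fun _ j => esym (WbarE j q)) tT2).
Qed.
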